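(* Let $q$ be an odd prime power, $m\geq 2$ and $n=\frac{q^m-1}{2}$. Let $\delta_1,\delta_2,\delta_3$ be the first, second and third largest odd coset leaders modulo $q^m-1$, and let $\kappa=\frac{m}{3}$ if $m\equiv 0\pmod 3$ and $\kappa=m$ if $m\not\equiv 0\pmod 3$. Let $\delta$ be an integer. Then the negacyclic BCH code $\mathcal{C}_{(q,n,\delta,0)}$ has parameters $[\frac{q^m-1}{2}, m, \frac{\delta_1+1}{2}]$ if $\frac{\delta_2+3}{2}\leq\delta\leq\frac{\delta_1+1}{2}$, and $[\frac{q^m-1}{2}, m+\kappa, d\geq\frac{\delta_2+1}{2}]$ if $\frac{\delta_3+3}{2}\leq\delta\leq\frac{\delta_2+1}{2}$. Furthermore, if $q^m\geq 25$, the negacyclic BCH code $\mathcal{C}_{(q,n,(\delta_3+1)/2,0)}$ has parameters $[\frac{q^m-1}{2}, 2m+\kappa, d\geq \frac{\delta_3+1}{2}]$.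
   Context: For positive integers $N$ and $0\leq i\leq N-1$, the $q$-cyclotomic coset of $i$ modulo $N$ is $C_i^{(q,N)}=\{i,iq,iq^2,\ldots\}\bmod N\subseteq\mathbb{Z}_N$; its smallest element is its coset leader. An odd coset leader modulo $N$ is a coset leader modulo $N$ which is an odd integer; $\delta_i$ denotes the $i$-th largest one. Negacyclic BCH codes: let $n$ be a positive integer with $\gcd(n,q)=1$, $\ell$ the order of $q$ modulo $2n$, $\alpha$ a primitive element of $\mathrm{GF}(q^\ell)$, $\beta=\alpha^{(q^\ell-1)/(2n)}$ (a primitive $2n$-th root of unity), and $\mathbb{M}_{\beta^{j}}(x)$ the minimal polynomial of $\beta^j$ over $\mathrm{GF}(q)$. For $2\leq\delta\leq n$, $\mathcal{C}_{(q,n,\delta,0)}$ is the negacyclic code of length $n$ over $\mathrm{GF}(q)$, i.e. the ideal of $\mathrm{GF}(q)[x]/(x^n+1)$, generated by $\mathrm{lcm}\big(\mathbb{M}_{\beta^{1}}(x),\mathbb{M}_{\beta^{3}}(x),\ldots,\mathbb{M}_{\beta^{1+2(\delta-2)}}(x)\big)$. Parameters $[n,k,d]$ are length, dimension, minimum Hamming distance. *)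

(* Defs.v *)
From HB Require Import structures.
From mathcomp Require Import all_boot all_order all_algebra all_field.
Set Implicit Arguments. Unset Strict Implicit. Unset Printing Implicit Defensive.
Import GRing.Theory.
Local Open Scope ring_scope.

Definition is_coset_leader (q N i : nat) : bool :=
  (i < N)%N && [forall k : 'I_N, (i <= (i * q ^ k) %% N)%N].
(* note: q has order dividing phi(N) < N modulo N when gcd(q,N)=1, and in
   general the exponents 0..N-1 already enumerate every element of C_i. *)

Definition odd_coset_leaders (q N : nat) : seq nat :=
  [seq i <- iota 0 N | odd i && is_coset_leader q N i].

(* delta q N k = the k-th largest odd coset leader modulo N (k >= 1);
   0 if there are fewer than k of them *)
Definition delta (q N k : nat) : nat :=
  nth 0%N (sort geq (odd_coset_leaders q N)) k.-1.

Definition lcmp (K : fieldType) (p r : {poly K}) : {poly K} :=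
  (p * r) %/ gcdp p r.

(* F = GF(q), L an extension field of F containing beta, a primitive
   2n-th root of unity.  The generator polynomial is
   lcm(M_{beta^1}, M_{beta^3}, ..., M_{beta^(1+2(delta-2))}), where
   M_a = minPoly 1 a is the minimal polynomial of a over F (a polynomial
   with coefficients in F, seen in L[x]).  A word c in F^n is identified with
   the polynomial c_0 + c_1 x + ... + c_{n-1} x^(n-1); c is in the code iff it
   lies in the ideal of F[x]/(x^n+1) generated by g, i.e.
   c = a * g mod (x^n + 1) for some a in F[x] (a may be taken of degree < n). *)
Definition bch_generator (F : fieldType) (L : fieldExtType F) (delta : nat)
    (beta : L) : {poly L} :=
  \big[@lcmp L/1]_(i < delta.-1) minPoly 1%VS (beta ^+ (2 * i + 1)).

Definition negacyclic_BCH (F : finFieldType) (L : fieldExtType F)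
    (n delta : nat) (beta : L) : {set 'rV[F]_n} :=
  [set c : 'rV[F]_n | [exists a : 'rV[F]_n,
     map_poly (in_alg L) (rVpoly c) ==
     (map_poly (in_alg L) (rVpoly a) * bch_generator delta beta)
       %% ('X^n + 1)]].

Definition code_dim (F : finFieldType) (n : nat) (C : {set 'rV[F]_n}) : nat :=
  \dim <<enum C>>%VS.

Definition hamming (F : finFieldType) (n : nat) (x y : 'rV[F]_n) : nat :=
  #|[set i : 'I_n | x 0 i != y 0 i]|.

Definition is_min_dist (F : finFieldType) (n : nat) (C : {set 'rV[F]_n})
    (d : nat) : Prop :=
  (exists x, exists y, [/\ x \in C, y \in C, x != y & hamming x y = d]) /\
  (forall x y, x \in C -> y \in C -> x != y -> (d <= hamming x y)%N).

Definition min_dist_ge (F : finFieldType) (n : nat) (C : {set 'rV[F]_n})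
    (b : nat) : Prop :=
  (1 < #|C|)%N /\
  (forall x y, x \in C -> y \in C -> x != y -> (b <= hamming x y)%N).

(* Main.v *)
Require Import Defs.
From HB Require Import structures.
From mathcomp Require Import all_boot all_order all_algebra all_field.
From mathcomp Require Import zify.
Set Implicit Arguments. Unset Strict Implicit. Unset Printing Implicit Defensive.
Import GRing.Theory.
Local Open Scope ring_scope.

(** Put [N = q^m - 1].  The reflection [i -> N - i] turns odd coset leaders into
    odd numbers [M] that are largest in their cosets, and multiplication by [q]
    rotates the [q]-ary digits of [M].  The smallest such numbers are
    [q^(m-1)] (word 10...0) and the word with three digits 1 spaced as evenly as
    possible, with orbits of size [m] and [kappa].  The third one is not computed:
    if its orbit had fewer than [m] elements, it would be [u (1 + q^d + ...)] with
    an odd number [>= 3] of terms, and an explicit three-digit word would lie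
    strictly between it and the second one.

    The generator polynomial has the roots [beta^s], [s] odd, with coset leader of
    [s] below [2 delta - 2], so the dimension is the total size of the remaining
    odd cosets.  The odd exponents below the least remaining leader give the BCH
    bound, and in the first case averaging the weight over all codewords shows
    that the bound is attained. *)

(** * Digit rotations and odd coset leaders *)

Section Rotations.
Local Open Scope nat_scope.
Variables q m : nat.
Hypotheses (q_odd : odd q) (q_gt2 : 2 < q) (m_gt1 : 1 < m).
Local Notation N := (q ^ m).-1.

Definition coset_max (M : nat) : Prop :=
  (0 < M < N) /\ forall j, (M * q ^ j) %% N <= M.


Lemma expn_add_le (a b c d : nat) :
  b <= a -> d <= c -> q ^ a + q ^ b <= q ^ c + q ^ d -> a <= c.
Proof.
move=> ba dc h; rewrite leqNgt; apply/negP => lt_ca.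
have := @leq_pexp2l q c.+1 a ltac:(lia) lt_ca; rewrite expnS.
have := @leq_pexp2l q d c ltac:(lia) dc.
have := expn_gt0 q b; have := expn_gt0 q c; nia.
Qed.

Lemma expn_add_lt (a b c d : nat) :
  b <= a -> a < c -> q ^ a + q ^ b < q ^ c + q ^ d.
Proof.
move=> ba ac.
have := @leq_pexp2l q a.+1 c ltac:(lia) ac; rewrite expnS.
have := @leq_pexp2l q b a ltac:(lia) ba.
have := expn_gt0 q d; have := expn_gt0 q a; nia.
Qed.

Lemma q_expm_gt8 : 8 < q ^ m.
Proof.
have := @leq_pexp2l q 2 m ltac:(lia) m_gt1; rewrite expnS expn1; nia.
Qed.

Lemma N_even : odd N = false.
Proof.
have := oddX q m; rewrite q_odd orbT; case: (q ^ m) => //= k; exact: negbTE.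
Qed.

Lemma N_gt0 : 0 < N. Proof. have := q_expm_gt8; lia. Qed.

Lemma m_le_N : m <= N.
Proof. by have := ltn_expl m (_ : 1 < q); lia. Qed.

Lemma expm_eq1_modN : q ^ m = 1 %[mod N].
Proof.
have {1}-> : q ^ m = 1 * N + 1 by have := q_expm_gt8; lia.
by rewrite modnMDl.
Qed.

Lemma expn_modN j : q ^ j = q ^ (j %% m) %[mod N].
Proof.
rewrite {1}(divn_eq j m) expnD mulnC (mulnC _ m) expnM -modnMmr -modnXm.
by rewrite expm_eq1_modN modnXm exp1n modnMmr muln1.
Qed.

Lemma coprime_N_expn j : coprime N (q ^ j).
Proof.
apply: coprimeXr; rewrite -(coprime_pexpr _ _ (_ : 0 < m)); last lia.
by rewrite -{2}(prednK (_ : 0 < q ^ m)) ?coprimenS // expn_gt0; lia.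
Qed.

Lemma modN_expnK a b j : a * q ^ j = b * q ^ j %[mod N] -> a = b %[mod N].
Proof.
wlog ba : a b / b <= a => [hw h | /eqP].
  by case/orP: (leq_total a b) => ab; [symmetry|]; apply: hw.
rewrite eqn_mod_dvd ?leq_mul2r ?ba ?orbT // -mulnBl Gauss_dvdl ?coprime_N_expn //.
by rewrite -eqn_mod_dvd // => /eqP.
Qed.

(** Both residues lie strictly between 0 and [N] because [q] is invertible modulo [N], and [N]
    divides their sum. *)
Lemma coset_max_refl i k : i < N -> 0 < i ->
  (i * q ^ k) %% N + ((N - i) * q ^ k) %% N = N.
Proof.
move=> iN i0.
have nz x : 0 < x < N -> 0 < (x * q ^ k) %% N < N.
  move=> /andP[x0 xN]; rewrite ltn_mod N_gt0 andbT lt0n; apply/negP.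
  rewrite -/(dvdn _ _) Gauss_dvdl ?coprime_N_expn // => /dvdn_leq; lia.
have h : N %| (i * q ^ k) %% N + ((N - i) * q ^ k) %% N.
  rewrite /dvdn modnDm -mulnDl subnKC ?modnMr ?modnMl //; lia.
have := nz i ltac:(lia); have := nz (N - i) ltac:(lia).
case/dvdnP: h => c e h1 h2.
have : c * N < 2 * N by lia.
have : 0 * N < c * N by lia.
rewrite !ltn_pmul2r ?N_gt0 // => c0 c2.
by rewrite e (_ : c = 1) ?mul1n //; lia.
Qed.

Lemma coset_leader_maxP i : odd i -> i < N ->
  reflect (coset_max (N - i)) (is_coset_leader q N i).
Proof.
move=> oi iN; have i0 : 0 < i by case: i oi {iN}.
apply: (iffP andP) => [[_ /forallP h]|[_ h]]; split=> //; first lia.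
  (* [is_coset_leader] tests only exponents below [N], so [j] is first reduced modulo [m]. *)
  move=> j; rewrite -modnMmr expn_modN modnMmr.
  have jm : j %% m < N by apply: leq_trans m_le_N; rewrite ltn_mod; lia.
  have := h (Ordinal jm) => /=; have := coset_max_refl (j %% m) iN i0; lia.
by apply/forallP => k; have := h k; have := coset_max_refl k iN i0; lia.
Qed.

Lemma coset_max_leader M : odd M -> coset_max M ->
  [/\ odd (N - M), N - M < N & is_coset_leader q N (N - M)].
Proof.
move=> oM hM; case: (hM) => /andP[M0 MN] _.
have oNM : odd (N - M) by rewrite oddB ?N_even ?oM // ltnW.
have lt : N - M < N by lia.
by split=> //; apply/coset_leader_maxP => //; rewrite subKn // ltnW.
Qed.

(** Below [q ^ m.-1] the top digit is zero, so multiplying by [q] gives a larger number without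
    wrapping around. *)
Lemma coset_max_ge M : coset_max M -> q ^ m.-1 <= M.
Proof.
move=> [/andP[M0 MN] h]; rewrite leqNgt; apply/negP => lt.
have e : q ^ m = q * q ^ m.-1 by rewrite -expnS prednK //; lia.
have := h 1; rewrite expn1 modn_small; nia.
Qed.

(** * Explicit words that are largest in their cosets *)

Lemma mod3_rot a b c j :
  ((q ^ a + q ^ b + q ^ c) * q ^ j) %% N <=
  q ^ ((a + j) %% m) + q ^ ((b + j) %% m) + q ^ ((c + j) %% m).
Proof.
rewrite !mulnDl -!expnD -modnDm -(modnDm (q ^ (a + j))).
rewrite (expn_modN (a + j)) (expn_modN (b + j)) (expn_modN (c + j)).
by rewrite modnDm -modnDml modnDm modnDml; apply: leq_mod.
Qed.

(** Digits 1 in positions [m - 1], [m - 1 - g1] and [g3 - 1], so that [g3] is the gap from the last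
    digit cyclically back to the first. *)
Definition pow3 g1 g3 := q ^ m.-1 + q ^ (m.-1 - g1) + q ^ g3.-1.

Lemma odd_pow3 g1 g3 : odd (pow3 g1 g3).
Proof. by rewrite /pow3 !oddD !oddX q_odd !orbT. Qed.

Lemma pow3_lt g1 g3 : 0 < g1 -> g1 < m -> g3.-1 < m.-1 -> pow3 g1 g3 < 2 * q ^ m.-1.
Proof.
rewrite /pow3 => h1 h2 h3.
have := @leq_pexp2l q (m.-1 - g1) m.-2 ltac:(lia) ltac:(lia).
have := @leq_pexp2l q g3.-1 m.-2 ltac:(lia) ltac:(lia).
have -> : q ^ m.-1 = q * q ^ m.-2 by rewrite -expnS; congr (_ ^ _); lia.
have := expn_gt0 q m.-2; nia.
Qed.

Lemma two_pow_lt_N : 2 * q ^ m.-1 + 1 < N.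
Proof.
have -> : q ^ m = q * q ^ m.-1 by rewrite -expnS prednK //; lia.
have := @leq_pexp2l q 1 m.-1 ltac:(lia) ltac:(lia); rewrite expn1; nia.
Qed.

(* [g1, g2, g3] are the cyclic gaps between the three nonzero digits; the
   hypotheses say that [(g1, g2, g3)] is lexicographically least among its
   rotations. *)
Lemma coset_max_pow3 g1 g2 g3 : 0 < g1 -> 0 < g2 -> 0 < g3 ->
  g1 + g2 + g3 = m ->
  g1 < g2 \/ g1 = g2 /\ g2 <= g3 -> g1 < g3 \/ g1 = g3 /\ g2 <= g1 ->
  coset_max (pow3 g1 g3).
Proof.
move=> h1 h2 h3 hm c2 c3; split.
  have := two_pow_lt_N; have := @pow3_lt g1 g3 h1 ltac:(lia) ltac:(lia).
  have := odd_pow3 g1 g3; lia.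
move=> j; rewrite -modnMmr expn_modN modnMmr.
have : j %% m < m by rewrite ltn_mod; lia.
move: (j %% m) => {}j jm; apply: leq_trans (mod3_rot _ _ _ _) _.
have md x : x < m + m -> x %% m = if x < m then x else x - m.
  move=> xm; case: ltnP => [/modn_small //|mx].
  by rewrite -{1}(subnK mx) modnDr modn_small //; lia.
rewrite !md; try lia.
have [->|j0] := posnP j; first by rewrite !addn0 !ifT //; lia.
rewrite ifF; last by lia.
(* This rotation brings the second digit to the top; the gaps become [(g2, g3, g1)]. *)
have [e|n1] := eqVneq j g1.
  rewrite ifT ?ifT; try lia; subst j.
  have -> : m.-1 - g1 + g1 = m.-1 by lia.
  have -> : m.-1 + g1 - m = g1.-1 by lia.
  have -> : g3.-1 + g1 = m.-1 - g2 by lia.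
  rewrite /pow3; case: c2 => [lt|[<- le23]].
    have := @expn_add_lt (m.-1 - g2) g1.-1 (m.-1 - g1) g3.-1 ltac:(lia) ltac:(lia); lia.
  have := @leq_pexp2l q g1.-1 g3.-1 ltac:(lia) ltac:(lia); lia.
(* Now the third digit comes to the top; the gaps become [(g3, g1, g2)]. *)
have [e|n2] := eqVneq j (g1 + g2).
  rewrite ifF ?ifT; try lia; subst j.
  have -> : g3.-1 + (g1 + g2) = m.-1 by lia.
  have -> : m.-1 + (g1 + g2) - m = m.-1 - g3 by lia.
  have -> : m.-1 - g1 + (g1 + g2) - m = g2.-1 by lia.
  rewrite /pow3; case: c3 => [lt|[<- le23]].
    have := @expn_add_lt (m.-1 - g3) g2.-1 (m.-1 - g1) g3.-1 ltac:(lia) ltac:(lia); lia.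
  have := @leq_pexp2l q g2.-1 g1.-1 ltac:(lia) ltac:(lia); lia.
(* In every other rotation the top digit is zero, and three lower powers add up to at most
   [q ^ m.-1]. *)
have e : q ^ m.-1 = q * q ^ m.-2 by rewrite -expnS; congr (_ ^ _); lia.
have le x : x <= m.-2 -> q ^ x <= q ^ m.-2 by move=> hx; rewrite leq_pexp2l //; lia.
have e3 : 3 * q ^ m.-2 <= q ^ m.-1 by rewrite e leq_mul2r q_gt2 orbT.
apply: (@leq_trans (3 * q ^ m.-2)); last by rewrite /pow3; lia.
rewrite (_ : 3 * _ = q ^ m.-2 + q ^ m.-2 + q ^ m.-2); last by lia.
by rewrite !leq_add // le //; try case: ltnP; lia.
Qed.

Lemma coset_max_pow1 : coset_max (q ^ m.-1).
Proof.
split; first by have := two_pow_lt_N; have := expn_gt0 q m.-1; lia.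
move=> j; rewrite -expnD expn_modN; apply: leq_trans (leq_mod _ _) _.
by rewrite leq_pexp2l //; [lia|have := ltn_pmod (m.-1 + j) (_ : 0 < m); lia].
Qed.

(** The word 20...01. It is [second_max] when [m = 2], and it yields a third odd leader when
    [m >= 3]. *)
Lemma coset_max_2pow1 : coset_max (2 * q ^ m.-1 + 1).
Proof.
split; first by have := two_pow_lt_N; lia.
move=> j; rewrite -modnMmr expn_modN modnMmr.
have : j %% m < m by rewrite ltn_mod; lia.
move: (j %% m) => {}j jm.
have -> : 2 * q ^ m.-1 + 1 = q ^ m.-1 + q ^ m.-1 + q ^ 0 by rewrite expn0; lia.
have [->|j0] := posnP j; first by rewrite expn0 muln1 leq_mod.
apply: leq_trans (mod3_rot _ _ _ _) _; rewrite add0n (modn_small jm).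
have -> : m.-1 + j = j.-1 + m by lia.
rewrite modnDr modn_small; last by lia.
have := @leq_pexp2l q j m.-1 ltac:(lia) ltac:(lia).
have -> : q ^ j = q * q ^ j.-1 by rewrite -expnS prednK.
rewrite expn0; nia.
Qed.

(** The word 30 yields a third odd leader when [m = 2]; its other rotation is 3. *)
Lemma coset_max_3pow1 : m = 2 -> 4 < q -> coset_max (3 * q).
Proof.
move=> m2 q4; have e : N = q * q - 1 by rewrite m2 expnS expn1; lia.
split; first by rewrite e; nia.
move=> j; rewrite -modnMmr expn_modN modnMmr m2.
have : j %% 2 < 2 by rewrite ltn_mod.
case: (j %% 2) => [|[|//]] _; first by rewrite expn0 muln1 -m2 leq_mod.
have -> : 3 * q * q ^ 1 = 3 * (q ^ 2).-1 + 3 by rewrite expn1 expnS expn1; nia.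
by rewrite modnMDl; apply: leq_trans (leq_mod _ _) _; lia.
Qed.

(** The gaps are [m %/ 3], [(m + 1) %/ 3], [(m + 2) %/ 3]. For [m = 2] the first gap is 0 and the
    two leading digits merge into a 2. *)
Definition second_max := pow3 (m %/ 3) ((m + 2) %/ 3).

Lemma second_max_le : second_max <= 2 * q ^ m.-1 + 1.
Proof.
have [m3|m3] := leqP 3 m.
  by have := @pow3_lt (m %/ 3) ((m + 2) %/ 3); rewrite /second_max; lia.
have -> : second_max = 2 * q ^ m.-1 + 1; last by [].
by have e : m = 2 by [lia]; rewrite /second_max /pow3 e /= expn0 expn1; lia.
Qed.

Lemma coset_max_second : coset_max second_max.
Proof.
have [m3|m3] := leqP 3 m.
  by apply: (@coset_max_pow3 _ ((m + 1) %/ 3)); lia.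
have -> : second_max = 2 * q ^ m.-1 + 1; last exact: coset_max_2pow1.
by have e : m = 2 by [lia]; rewrite /second_max /pow3 e /= expn0 expn1; lia.
Qed.

(** * Minimality of [second_max] *)

Lemma expn_bracket x : 0 < x -> exists2 p, q ^ p <= x & x < q ^ p.+1.
Proof.
by move=> x0; exists (trunc_log q x); [apply: trunc_logP|apply: trunc_log_ltn]; lia.
Qed.

(** [A] holds the top [j] digits and [B] the others; rotation by [j] exchanges the two blocks. *)
Lemma coset_max_rot M A B j : coset_max M -> j <= m ->
  M = A * q ^ (m - j) + B -> A + B * q ^ j < N -> A + B * q ^ j <= M.
Proof.
move=> [_ hM] jm eM lt; apply: leq_trans (hM j).
rewrite [in leqRHS]eM mulnDl -mulnA -expnD subnK // -modnDml.
by rewrite -modnMmr expm_eq1_modN modnMmr muln1 modnDml modn_small.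
Qed.

Lemma triple_expn a b : a < b -> 3 * q ^ a <= q ^ b.
Proof.
move=> ab; apply: leq_trans (leq_pexp2l _ ab); last by lia.
by rewrite expnS leq_mul2r q_gt2 orbT.
Qed.

Lemma first_rotation M p t R : coset_max M -> m = p + t.+2 ->
  M = q ^ (p + t.+1) + R -> R < q ^ p.+1 -> q ^ t + R * q ^ t.+1 <= M.
Proof.
move=> hM em eM Rp; apply: (coset_max_rot hM); first by rewrite em; lia.
  by rewrite eM -expnD; congr (_ ^ _ + _); rewrite em; lia.
have : R.+1 * q ^ t.+1 <= q ^ p.+1 * q ^ t.+1 by rewrite leq_mul2r Rp orbT.
rewrite -expnD (_ : p.+1 + t.+1 = m) ?mulSn; last by rewrite em; lia.
have := triple_expn (ltnSn t); have := expn_gt0 q t; lia.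
Qed.

(** The rotation puts the digit in position [s] on top. The shifted [S] is at least [q ^ m.-1] plus
    the rest of [S]; cancelling these leaves a comparison of two pairs of powers. *)
Lemma second_rotation M s t u S : coset_max M -> m = s + u.+1 + t.+2 ->
  M = q ^ (s + u.+1 + t.+1) + q ^ (s + u.+1) + S ->
  q ^ s <= S < q ^ s.+1 ->
  q ^ (u + t.+1) + q ^ u <= q ^ (s + u.+1) + q ^ s.
Proof.
move=> hM em eM /andP[sS Ss]; set j := u.+1 + t.+1.
have e1 : q ^ s * q ^ j = q ^ (s + u.+1 + t.+1) by rewrite -expnD /j addnA.
have rot : q ^ (u + t.+1) + q ^ u + S * q ^ j <= M.
  apply: (coset_max_rot hM); first by rewrite em /j; lia.
    rewrite eM mulnDl -!expnD; congr (_ ^ _ + _ ^ _ + _); rewrite em /j; lia.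
  have : S.+1 * q ^ j <= q ^ s.+1 * q ^ j by rewrite leq_mul2r Ss orbT.
  rewrite -expnD (_ : s.+1 + j = m) ?mulSn; last by rewrite em /j; lia.
  have := @triple_expn u (u + t.+1) ltac:(lia).
  have := @triple_expn (u + t.+1) j ltac:(rewrite /j; lia).
  have := expn_gt0 q u; lia.
have [U eU] : exists U, S = q ^ s + U by exists (S - q ^ s); lia.
have : U <= U * q ^ j by rewrite leq_pmulr // expn_gt0; lia.
by move: rot; rewrite eM eU mulnDl e1; lia.
Qed.

(* Comparing [M] with its rotations starting at the second and third nonzero
   digits [q^p] and [q^s] shows that the first gap between nonzero digits is the
   least one. *)
Lemma gaps_coset_max M : odd M -> coset_max M ->
  q ^ m.-1 < M < 2 * q ^ m.-1 ->
  exists s t u, [/\ m = s + u.+1 + t.+2,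
    q ^ m.-1 + q ^ (s + u.+1) + q ^ s <= M, t <= u, t <= s & t = s -> u <= s].
Proof.
move=> oM hM /andP[M1 small].
have oq j : odd (q ^ j) by rewrite oddX q_odd orbT.
have [R eR] : exists R, M = q ^ m.-1 + R by exists (M - q ^ m.-1); lia.
have [p pR Rp] := @expn_bracket R ltac:(lia).
have pm : p < m.-1 by rewrite -(@ltn_exp2l q); lia.
have [t em] : exists t, m = p + t.+2 by exists (m - p).-2; lia.
have em1 : m.-1 = p + t.+1 by rewrite em; lia.
have [S eS] : exists S, R = q ^ p + S by exists (R - q ^ p); lia.
(* Removing two odd powers from the odd [M] leaves an odd, hence nonzero, remainder: there is a
   third nonzero digit. *)
have oS : odd S by move: oM; rewrite eR eS !oddD !oq /=; case: (odd S).
have [s sS Ss] := @expn_bracket S ltac:(by case: (S) oS).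
have epj : q ^ p * q ^ t.+1 = q ^ m.-1 by rewrite -expnD em1.
rewrite em1 in eR.
have rot1 : S * q ^ t.+1 < q ^ p + S.
  have := first_rotation hM em eR Rp; rewrite eS in eR *; rewrite eR mulnDl -em1 epj.
  by have := expn_gt0 q t; lia.
(* Hence the digit of [M] in position [p] is exactly 1. *)
have lt_Sp : S < q ^ p.
  have : S * 3 <= S * q ^ t.+1.
    have := @triple_expn 0 t.+1 ltac:(by []); rewrite expn0 muln1 => q3.
    by rewrite leq_mul2l q3 orbT.
  by lia.
have sp : s < p by rewrite -(@ltn_exp2l q); lia.
have [u ep] : exists u, p = s + u.+1 by exists (p - s).-1; lia.
(* If [u < t], shifting by [t.+1] would lift [q ^ s] above position [p], against [rot1]. *)
have tu : t <= u.
  have [U eU] : exists U, S = q ^ s + U by exists (S - q ^ s); lia.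
  rewrite leqNgt; apply/negP => lt.
  have := @triple_expn p (s + t.+1) ltac:(rewrite ep; lia).
  have := triple_expn sp; rewrite expnD.
  have : U <= U * q ^ t.+1 by rewrite leq_pmulr // expn_gt0; lia.
  by move: rot1; rewrite eU mulnDl; lia.
have eM : M = q ^ (s + u.+1 + t.+1) + q ^ (s + u.+1) + S by rewrite eR eS ep addnA.
rewrite ep in em.
have rot2 := second_rotation hM em eM ltac:(by rewrite sS Ss).
exists s, t, u; split=> //; first by rewrite em1 ep eM; lia.
  by have := @expn_add_le (u + t.+1) u (s + u.+1) s ltac:(lia) ltac:(lia) rot2; lia.
move=> ts; move: rot2; rewrite ts (_ : u + s.+1 = s + u.+1); last by lia.
by rewrite leq_add2l leq_exp2l //; lia.
Qed.

(** The gaps [t.+1], [u.+1], [s.+1] add up to [m] and the first is least, so [t.+1 <= m %/ 3]; in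
    case of equality, the tie rule [t = s -> u <= s] keeps [s] large enough. *)
Lemma second_max_min M : odd M -> coset_max M -> q ^ m.-1 < M -> second_max <= M.
Proof.
move=> oM hM M1; have [big|small] := leqP (2 * q ^ m.-1) M.
  by apply: leq_trans second_max_le _; lia.
have [|s [t [u [em le tu ts tsu]]]] := gaps_coset_max oM hM; first by rewrite M1.
apply: leq_trans le; rewrite /second_max /pow3.
have [lt|ge] := ltnP (m.-1 - m %/ 3) (s + u.+1).
  by have := @expn_add_lt (m.-1 - m %/ 3) ((m + 2) %/ 3).-1 (s + u.+1) s ltac:(lia) lt; lia.
have -> : m.-1 - m %/ 3 = s + u.+1 by lia.
have := @leq_pexp2l q ((m + 2) %/ 3).-1 s ltac:(lia) ltac:(lia); lia.
Qed.

(** * Periods shorter than [m] *)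

(* A period [j] of [M] is refined to the divisor [d = gcd(j, m)] of [m]; then
   [M = u * (1 + q^d + ... + q^((e - 1) d))] with [e = m / d], and [e] is odd
   because [M] is. *)
Lemma odd_periodic M j : odd M -> M < N -> q ^ m.-1 <= M -> 0 < j < m ->
  M * q ^ j = M %[mod N] ->
  exists2 d, 0 < d &
    (exists u, [/\ m = 3 * d, M = u * (q ^ (2 * d) + q ^ d + 1), odd u & q ^ d.-1 <= u]) \/
    5 * d <= m /\ q ^ m.-1 + q ^ (m.-1 - d) + q ^ (m.-1 - 2 * d) < M.
Proof.
move=> oM MN M1 /andP[j0 jm] per.
have per_mul a : M * q ^ (a * j) = M %[mod N].
  elim: a => [|a IHa]; first by rewrite mul0n expn0 muln1.
  by rewrite mulSn expnD mulnA -modnMml per modnMml.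
(* Bezout: since [j] and [m] are periods, so is [gcdn j m]. *)
have [a [b ab]] : exists a b, a * j = b * m + gcdn j m.
  by case: (egcdnP m j0) => a b ab _; exists a, b.
have d0 : 0 < gcdn j m by rewrite gcdn_gt0 j0.
have /dvdnP[e em] : gcdn j m %| m := dvdn_gcdr j m.
have dj : gcdn j m <= j by rewrite dvdn_leq ?dvdn_gcdl.
have perd : M * q ^ gcdn j m = M %[mod N].
  rewrite -[in RHS](per_mul a) ab expnD (mulnC b) expnM -[in RHS]modnMmr.
  have eb : (q ^ m) ^ b = 1 %[mod N] by rewrite -modnXm expm_eq1_modN modnXm exp1n.
  by rewrite -[in RHS](modnMml (_ ^ b)) eb modnMml mul1n modnMmr.
have dm := leq_ltn_trans dj jm.
move: (gcdn j m) d0 em dm perd => d d0 em dm perd.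
clear j j0 jm per per_mul a b ab dj.
pose R n := \sum_(i < n) (q ^ d) ^ i.
have RN n : ((q ^ d) ^ n).-1 = (q ^ d).-1 * R n by rewrite predn_exp.
have qd3 : 3 <= q ^ d by have := triple_expn d0; rewrite expn0 muln1.
(* [N = (q ^ d - 1) * R e] divides [M * (q ^ d - 1)], hence [R e] divides [M]. *)
have [u eM] : exists u, M = u * R e.
  apply/dvdnP; rewrite -(@dvdn_pmul2l (q ^ d).-1); last by clear -qd3; lia.
  rewrite -RN -expnM (mulnC d) -em.
  have -> : (q ^ d).-1 * M = M * q ^ d - M by rewrite -subn1 mulnBl mul1n mulnC.
  by rewrite -eqn_mod_dvd ?leq_pmulr ?(leq_trans _ qd3) //; apply/eqP.
have [e2 eE] : exists e2, e = e2.+2.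
  by exists e.-2; case: (e) em => [|[|//]] em; move: dm d0; rewrite em ?mul1n ?ltnn.
have em1 : m.-1 = d.-1 + d * e2.+1 by rewrite em eE; clear -d0; lia.
(* A repeated block with leading digit zero would make [M] smaller than [q ^ m.-1]. *)
have u_ge : q ^ d.-1 <= u.
  rewrite leqNgt; apply/negP => lt.
  have : u.+1 * R e <= q ^ d.-1 * R e by rewrite leq_mul2r lt orbT.
  have qR : q ^ d.-1 * (q ^ d) ^ e2.+1 = q ^ m.-1.
    by rewrite -expnM -expnD em1.
  have := RN e2.+1; have : q ^ d.-1 * R e2.+1 <= (q ^ d).-1 * R e2.+1.
    rewrite leq_mul2r; apply/orP; right.
    have := @triple_expn d.-1 d ltac:(clear -d0; lia).
    by have := expn_gt0 q d.-1; clear -q_gt2; lia.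
  have : 0 < (q ^ d) ^ e2.+1 by rewrite -expnM expn_gt0; lia.
  have ReE : R e = R e2.+1 + (q ^ d) ^ e2.+1 by rewrite eE /R big_ord_recr.
  rewrite mulSn -eM ReE mulnDr qR; clear -M1; lia.
have odd_R n : odd (R n) = odd n.
  elim: n => [|n IHn]; first by rewrite /R big_ord0.
  by rewrite /R big_ord_recr oddD -/(R n) IHn /= !oddX q_odd !orbT addbT.
have [ou oe] : odd u /\ odd e by apply/andP; rewrite -(odd_R e) -oddM -eM.
(* [e = 2] and [e = 4] fail by parity, which leaves [e = 3] and [e >= 5]. *)
exists d => //; case: e2 em1 eE => [|[|e4]] em1 eE; [by rewrite eE in oe| |].
  left; exists u; split=> //; first by rewrite em eE.
  rewrite eM eE /R !big_ord_recr big_ord0 /= add0n expn0 expn1 -expnM.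
  by rewrite (mulnC d); clear; lia.
right; have e5 : 5 <= e by case: (e4) eE oe => [->|n ->].
split; first by rewrite em leq_mul2r e5 orbT.
rewrite em1.
have -> : d.-1 + d * e4.+3 - d = d.-1 + d * e4.+2 by clear -d0; lia.
have -> : d.-1 + d * e4.+3 - 2 * d = d.-1 + d * e4.+1 by clear -d0; lia.
(* The three top blocks give the three powers, and the lowest block makes the inequality strict. *)
apply: (@leq_trans (q ^ d.-1 * R e)); last by rewrite eM leq_mul2r u_ge orbT.
rewrite !expnD -!mulnDr !expnM eE /R 3!big_ord_recr /= big_ord_recl /= expn0.
have := expn_gt0 q d.-1; rewrite !mulnDr; clear -q_gt2; lia.
Qed.

(** A shorter period repeats the top block at least three times, which exceeds a single power. *)
Lemma pow1_aperiodic j : 0 < j < m -> q ^ m.-1 * q ^ j <> q ^ m.-1 %[mod N].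
Proof.
move=> jm /odd_periodic; rewrite oddX q_odd orbT => -[] //.
  by case: coset_max_pow1 => /andP[].
move=> d d0 [[u [em eM _ ud]]|[_]]; last by lia.
have : q ^ d.-1 * q ^ (2 * d) <= u * q ^ (2 * d) by rewrite leq_mul2r ud orbT.
rewrite -expnD (_ : d.-1 + 2 * d = m.-1); last by rewrite em; lia.
by have : 0 < q ^ d.-1 by [rewrite expn_gt0; lia]; rewrite eM !mulnDr muln1; lia.
Qed.

Lemma second_max_triple k : m = 3 * k -> 0 < k ->
  second_max = q ^ k.-1 * (q ^ (2 * k) + q ^ k + 1).
Proof.
move=> em k0; rewrite /second_max /pow3 !mulnDr -!expnD muln1.
by congr (_ ^ _ + _ ^ _ + _ ^ _); lia.
Qed.

Lemma second_max_lt_expn d : d <= m %/ 3 -> 2 * d <= m %/ 3 + (m + 1) %/ 3 -> 0 < m %/ 3 ->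
  second_max <= q ^ m.-1 + q ^ (m.-1 - d) + q ^ (m.-1 - 2 * d).
Proof.
move=> h1 h2 h3; rewrite /second_max /pow3.
have := @leq_pexp2l q (m.-1 - m %/ 3) (m.-1 - d) ltac:(lia) ltac:(lia).
have := @leq_pexp2l q ((m + 2) %/ 3).-1 (m.-1 - 2 * d) ltac:(lia) ltac:(lia).
lia.
Qed.

(** The number [kappa] of the theorem. *)
Definition second_size := if m %% 3 == 0 then m %/ 3 else m.

Lemma second_max_period : second_max * q ^ second_size = second_max %[mod N].
Proof.
rewrite /second_size; case: eqP => [m3|_]; last first.
  by rewrite -modnMmr expm_eq1_modN modnMmr muln1.
have em : m = 3 * (m %/ 3) by lia.
move: (m %/ 3) em => k em; rewrite (second_max_triple em); last by lia.
have -> : q ^ k.-1 * (q ^ (2 * k) + q ^ k + 1) * q ^ k =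
    q ^ k.-1 * N + q ^ k.-1 * (q ^ (2 * k) + q ^ k + 1).
  rewrite -mulnA -mulnDr; congr (_ * _).
  have -> : q ^ m = q ^ (2 * k) * q ^ k by rewrite -expnD em; congr (_ ^ _); lia.
  have -> : q ^ (2 * k) = q ^ k * q ^ k by rewrite -expnD; congr (_ ^ _); lia.
  have : 0 < q ^ k by rewrite expn_gt0; lia.
  by clear; nia.
by rewrite modnMDl.
Qed.

(** If 3 does not divide [m], a shorter period needs at least five equal blocks, which already
    exceed [second_max]. If [m = 3 * k], then [second_max] is [q ^ k.-1] times
    [Q = N / (q ^ k - 1)], and [Q * q ^ j] stays below [N] for [j < k]. *)
Lemma second_max_aperiodic j : 0 < j < second_size ->
  second_max * q ^ j <> second_max %[mod N].
Proof.
rewrite /second_size; case: eqP => [m3|m3] jk per; last first.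
  have [] := odd_periodic (odd_pow3 _ _) _ _ jk per.
  - by case: coset_max_second => /andP[].
  - by rewrite /second_max /pow3; lia.
  move=> d d0 [[u [em _ _ _]]|[d5]]; first by lia.
  by rewrite ltnNge second_max_lt_expn //; clear -d5 d0; lia.
have em : m = 3 * (m %/ 3) by lia.
move: (m %/ 3) em jk per => k em jk; rewrite (second_max_triple em); last by lia.
set Q := _ + 1 => /eqP; rewrite -mulnA !(mulnC (q ^ k.-1)) => /eqP/modN_expnK.
have eN : N = (q ^ k).-1 * Q.
  have -> : q ^ m = q ^ (2 * k) * q ^ k by rewrite -expnD em; congr (_ ^ _); lia.
  rewrite /Q; have -> : q ^ (2 * k) = q ^ k * q ^ k by rewrite -expnD; congr (_ ^ _); lia.
  have : 0 < q ^ k by rewrite expn_gt0; lia.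
  by clear; nia.
have jk3 := @triple_expn j k ltac:(lia).
have j3 := @triple_expn 0 j ltac:(lia); rewrite expn0 muln1 in j3.
have Q0 : 0 < Q by rewrite /Q addn1.
rewrite !modn_small.
- by move: j3 Q0; clear; nia.
- by rewrite eN -{1}(mul1n Q) ltn_mul2r Q0; lia.
- by rewrite eN mulnC ltn_mul2r Q0; lia.
Qed.

(* The witness is the next three-digit word after [second_max]. *)
Lemma pow3_next : 5 <= m -> exists g1 g3,
  [/\ coset_max (pow3 g1 g3), second_max < pow3 g1 g3, pow3 g1 g3 < 2 * q ^ m.-1,
      (forall d, 5 * d <= m -> d <= g1 /\ g3.-1 <= m.-1 - 2 * d) &
      (forall d, m = 3 * d -> g1 = d.-1 /\ g3 = d)].
Proof.
move=> m5; have [m3|m3] := eqVneq (m %% 3) 2.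
  (* With [k = m %/ 3], the gaps [(k, k + 1, k + 1)] are replaced by [(k, k, k + 2)]. *)
  exists (m %/ 3), (m %/ 3).+2; split.
  - by apply: (@coset_max_pow3 _ (m %/ 3)); lia.
  - by rewrite /second_max /pow3 ltn_add2l ltn_exp2l; lia.
  - by apply: pow3_lt; lia.
  - by move=> d d5; clear -d5 m3; lia.
  - by move=> d em; clear -em m3 m5; lia.
(* Here the first gap drops by one, the last is [m %/ 3], and the middle one takes the rest. *)
exists (m %/ 3).-1, (m %/ 3); split.
- by apply: (@coset_max_pow3 _ (m - (m %/ 3).-1 - m %/ 3)); lia.
- rewrite /second_max /pow3 -!addnA ltn_add2l.
  by apply: expn_add_lt; lia.
- by apply: pow3_lt; lia.
- by move=> d d5; clear -d5 m3; lia.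
- by move=> d em; clear -em m3 m5; lia.
Qed.

Lemma coset_max_between M j : odd M -> coset_max M -> second_max < M ->
  0 < j < m -> M * q ^ j = M %[mod N] ->
  exists M', [/\ odd M', coset_max M', second_max < M' & M' < M].
Proof.
move=> oM hM M2M jm per.
have M1M := coset_max_ge hM; have /andP[_ MN] := hM.1.
have [d d0 cases] := odd_periodic oM MN M1M jm per.
(* A period requires [m = 3 * d] or [5 * d <= m], so [m = 4] cannot occur; for [m = 3] the witness
   is the word 201. *)
have [m3|m5] : m = 3 \/ 5 <= m.
  case: cases => [[u [em _ _ _]]|[d5 _]]; first by clear -em d0; lia.
  by right; clear -d5 d0; lia.
  case: cases => [[u [em eM ou _]]|[d5 _]]; last by clear -m3 d5 d0; lia.
  have d1 : d = 1 by clear -m3 em; lia.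
  exists (2 * q ^ m.-1 + 1); split; [by rewrite oddD oddM| exact: coset_max_2pow1| |].
    have := @pow3_lt 1 1; rewrite /second_max m3 => /(_ isT isT isT) lt.
    by apply: ltn_trans lt _; rewrite addn1.
  move: M2M; rewrite {1}(@second_max_triple 1) // {1}eM d1 expn0 ltn_mul2r.
  move=> /andP[_ u1]; rewrite eM d1 m3; have u3 : 3 <= u by case: (u) ou u1 => [|[|[]]].
  have : 3 * q ^ 2 <= u * q ^ 2 by rewrite leq_mul2r u3 orbT.
  rewrite -[3.-1]/2 -[2 * 1]/2 !mulnDr muln1.
  by have : 0 < q ^ 2 by [rewrite expn_gt0; lia]; clear -u3; lia.
have [g1 [g3 [hM' M2M' M'lt h5 h3]]] := pow3_next m5.
exists (pow3 g1 g3); split=> //; first exact: odd_pow3.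
case: cases => [[u [em eM ou ud]]|[/h5[dg1 dg3] lt]]; last first.
  apply: leq_ltn_trans lt; rewrite /pow3 leq_add //; last first.
    by rewrite leq_pexp2l //; clear -q_gt2; lia.
  by rewrite leq_add2l leq_pexp2l //; clear -q_gt2 dg1; lia.
have [-> ->] := h3 _ em; rewrite /pow3.
have lt_du : q ^ d.-1 < u.
  by move: M2M; rewrite (second_max_triple em) // eM ltn_mul2r => /andP[].
(* Both [u] and [q ^ d.-1] are odd, so they differ by at least 2. *)
have u2 : (q ^ d.-1).+2 <= u.
  rewrite ltn_neqAle lt_du andbT; apply/negP => /eqP e.
  by move: ou; rewrite -e /= oddX q_odd orbT.
have e1 : m.-1 = d.-1 + 2 * d by clear -em d0; lia.
have -> : m.-1 - d.-1 = 2 * d by clear -e1; lia.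
have : (q ^ d.-1).+2 * q ^ (2 * d) <= u * q ^ (2 * d) by rewrite leq_mul2r u2 orbT.
rewrite e1 (expnD _ d.-1).
have := @triple_expn d.-1 (2 * d) ltac:(clear -d0; lia).
have := expn_gt0 q d.-1.
by rewrite eM !mulnDr muln1; clear -q_gt2; lia.
Qed.

(** * Cosets and their sizes *)

(** A coset with fewer than [m] elements is listed with repetitions; its size is therefore counted
    inside [iota 0 N]. *)
Definition coset i : seq nat := [seq (i * q ^ j) %% N | j <- iota 0 m].

Lemma cosetP s i : reflect (exists j, s = (i * q ^ j) %% N) (s \in coset i).
Proof.
apply: (iffP mapP) => [[j _ ->]|[j ->]]; first by exists j.
exists (j %% m); first by rewrite mem_iota add0n ltn_mod; lia.
by rewrite -modnMmr expn_modN modnMmr.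
Qed.

Lemma coset_refl i : i < N -> i \in coset i.
Proof. by move=> iN; apply/cosetP; exists 0; rewrite expn0 muln1 modn_small. Qed.

Lemma coset_lt s i : s \in coset i -> s < N.
Proof. by case/cosetP => j ->; rewrite ltn_mod N_gt0. Qed.

Lemma coset_trans i j k : j \in coset i -> k \in coset j -> k \in coset i.
Proof.
move=> /cosetP[a ->] /cosetP[b ->]; apply/cosetP; exists (a + b).
by rewrite modnMml -mulnA -expnD.
Qed.

Lemma coset_sym i j : i < N -> j \in coset i -> i \in coset j.
Proof.
move=> iN /cosetP[a ->]; apply/cosetP; exists (a * m.-1).
rewrite modnMml -mulnA -expnD -mulnS prednK; last by lia.
by rewrite mulnC -modnMml expn_modN modnMl expn0 modnMml mul1n modn_small.
Qed.

Lemma coset_odd i j : j \in coset i -> odd j = odd i.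
Proof.
case/cosetP => a ->; have := divn_eq (i * q ^ a) N.
move/(congr1 odd); rewrite oddD !oddM N_even andbF oddX q_odd orbT andbT /=.
by move->.
Qed.

Lemma leader_le i j : is_coset_leader q N i -> j \in coset i -> i <= j.
Proof.
case/andP=> iN /forallP h /mapP[k]; rewrite mem_iota add0n => /andP[_ km] ->.
have kN : k < N := leq_trans km m_le_N.
exact: (h (Ordinal kN)).
Qed.

(** Here [x] may exceed [N], as the exponents [2 * i + 1] of the generator can. *)
Lemma leader_le_coset i s x : is_coset_leader q N i ->
  s \in coset i -> s \in coset x -> i <= x.
Proof.
move=> li si sx; apply: leq_trans (leq_mod x N); apply: leader_le => //.
apply: coset_trans si (coset_sym _ _); first by rewrite ltn_mod N_gt0.
by case/cosetP: sx => j ->; apply/cosetP; exists j; rewrite modnMml.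
Qed.

Lemma leader_unique i i' s : is_coset_leader q N i -> is_coset_leader q N i' ->
  s \in coset i -> s \in coset i' -> i = i'.
Proof.
move=> li li' si si'; have [[iN _] [iN' _]] := (andP li, andP li').
apply/eqP; rewrite eqn_leq !leader_le //.
  by apply: coset_trans si' (coset_sym _ _).
by apply: coset_trans si (coset_sym _ _).
Qed.

Lemma leader_exists s : s < N -> exists2 i, is_coset_leader q N i & s \in coset i.
Proof.
move=> sN; have ex : exists i, i \in coset s by exists s; apply: coset_refl.
case: (ex_minnP ex) => i is_ min; exists i; last exact: coset_sym.
rewrite /is_coset_leader (coset_lt is_); apply/forallP => k; apply: min.
by apply: coset_trans is_ _; apply/cosetP; exists k.
Qed.

Lemma count_coset i p : 0 < p -> i * q ^ p = i %[mod N] ->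
  (forall j, 0 < j < p -> i * q ^ j <> i %[mod N]) ->
  count (mem (coset i)) (iota 0 N) = p.
Proof.
move=> p0 per aper; pose f j := (i * q ^ j) %% N.
have perM a : f (p * a) = f 0.
  elim: a => [|a IHa]; first by rewrite muln0.
  by rewrite mulnS /f expnD mulnA -modnMml per modnMml.
have fp j : f j = f (j %% p).
  rewrite {1}(divn_eq j p) mulnC /f expnD mulnA -modnMml -/(f _) perM.
  by rewrite /f modnMml expn0 muln1.
rewrite -size_filter -[p in RHS](size_mkseq f).
apply: perm_size; apply: uniq_perm.
- by rewrite filter_uniq ?iota_uniq.
- apply/mkseq_uniqP => a b; rewrite !inE.
  wlog ab : a b / a <= b.
    by move=> hw ap bp e; case/orP: (leq_total a b) => ab; [|symmetry]; apply: hw.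
  move=> ap bp e; apply/eqP; rewrite eqn_leq ab leqNgt; apply/negP => lt.
  apply: (aper (b - a)); first by lia.
  apply: (@modN_expnK _ _ a); rewrite -mulnA -expnD subnK //; exact/esym.
move=> s; rewrite mem_filter mem_iota add0n /=.
apply/andP/mapP => [[/cosetP[j ->] _]|[j _ ->]].
  exists (j %% p); last by rewrite -/(f j) fp.
  by rewrite mem_iota add0n ltn_mod.
by rewrite ltn_mod N_gt0; split=> //; apply/cosetP; exists j.
Qed.

(** * The three largest odd coset leaders *)

Lemma mem_odd_coset_leaders i :
  (i \in odd_coset_leaders q N) = odd i && is_coset_leader q N i.
Proof.
rewrite mem_filter mem_iota add0n /=.
by case: (odd i) => //=; case/boolP: (is_coset_leader q N i) => // /andP[->].
Qed.

Lemma odd_leaderE i : odd i -> is_coset_leader q N i ->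
  exists M, [/\ i = N - M, odd M, M < N & coset_max M].
Proof.
move=> oi li; have iN : i < N by case/andP: li.
exists (N - i); split; first by rewrite subKn // ltnW.
- by rewrite oddB ?oi ?N_even // ltnW.
- by have : 0 < i by [case: (i) oi]; lia.
- exact/coset_leader_maxP.
Qed.

Lemma odd_second_max : odd second_max. Proof. exact: odd_pow3. Qed.

Lemma odd_pow1 : odd (q ^ m.-1). Proof. by rewrite oddX q_odd orbT. Qed.

Lemma pow1_lt_second_max : q ^ m.-1 < second_max.
Proof. by rewrite /second_max /pow3; have := expn_gt0 q (m.-1 - m %/ 3); lia. Qed.

(** Reflection turns the lower bounds on coset maxima into upper bounds on leaders. The tail [s]
    stays abstract: its head, or 0 if it is empty, is [delta q N 3]. *)
Lemma deltaP : exists s,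
  [/\ sort geq (odd_coset_leaders q N) = [:: N - q ^ m.-1, N - second_max & s],
      sorted gtn s,
      forall x, x \in s -> [/\ odd x, is_coset_leader q N x & x < N - second_max] &
      forall x, odd x -> is_coset_leader q N x ->
        [\/ x = N - q ^ m.-1, x = N - second_max | x \in s]].
Proof.
set s := sort _ _.
have mem_s x : (x \in s) = odd x && is_coset_leader q N x.
  by rewrite mem_sort mem_odd_coset_leaders.
have sorted_s : sorted gtn s.
  rewrite gtn_sorted_uniq_geq sort_uniq filter_uniq ?iota_uniq //=.
  by apply: sort_sorted => a b; apply: leq_total.
have /andP[_ M2N] := coset_max_second.1; have M12 := pow1_lt_second_max.
have in1 : N - q ^ m.-1 \in s.
  by rewrite mem_s; have [-> _ ->] := coset_max_leader odd_pow1 coset_max_pow1.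
have in2 : N - second_max \in s.
  by rewrite mem_s; have [-> _ ->] := coset_max_leader odd_second_max coset_max_second.
have bound x : x \in s -> x = N - q ^ m.-1 \/ x <= N - second_max.
  rewrite mem_s => /andP[ox lx]; have [M [-> oM MN hM]] := odd_leaderE ox lx.
  have := coset_max_ge hM; rewrite leq_eqVlt => /orP[/eqP <-|lt]; first by left.
  by right; have := second_max_min oM hM lt; lia.
case: s sorted_s mem_s in1 in2 bound => [//|a [|b s]] sorted_s mem_s in1 in2 bound.
  by move: in1 in2; rewrite !inE => /eqP e1 /eqP e2; lia.
have /= /andP[ba path_b] := sorted_s.
have tr : transitive gtn by move=> x y z /= yx xz; apply: ltn_trans xz yx.
have /allP lt_b := order_path_min tr path_b.
have lt_a x : x \in b :: s -> x < a.
  by rewrite inE => /predU1P[->//|/lt_b] /= h; apply: ltn_trans h ba.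
have ea : a = N - q ^ m.-1.
  have := bound a (mem_head _ _); have [e|ne _] := eqVneq (N - q ^ m.-1) a; first by [].
  by move: in1; rewrite inE (negbTE ne) /= => /lt_a; case: (bound a (mem_head _ _)); lia.
have eb : b = N - second_max.
  have inb : b \in [:: a, b & s] by rewrite !inE eqxx orbT.
  move: in2; rewrite 2!inE => /or3P[/eqP e2|/eqP//|/lt_b /= lt]; first by lia.
  by case: (bound b inb); lia.
exists s; split; rewrite ?ea ?eb //.
- exact: path_sorted path_b.
- move=> x xs; have : x \in [:: a, b & s] by rewrite !inE xs !orbT.
  by rewrite mem_s => /andP[ox lx]; split=> //; rewrite -eb; apply: lt_b.
- move=> x ox lx; have : x \in [:: a, b & s] by rewrite mem_s ox.
  by rewrite !inE -ea -eb => /or3P[/eqP|/eqP|]; [constructor 1|constructor 2|constructor 3].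
Qed.

Lemma delta1E : delta q N 1 = N - q ^ m.-1.
Proof. by have [s [e _ _ _]] := deltaP; rewrite /delta e. Qed.

Lemma delta2E : delta q N 2 = N - second_max.
Proof. by have [s [e _ _ _]] := deltaP; rewrite /delta e. Qed.

Lemma delta3_lt : delta q N 3 < delta q N 2.
Proof.
rewrite delta2E; have [s [e _ s_lt _]] := deltaP; rewrite /delta e /=.
(* An empty tail gives the default value 0, which is below [N - second_max] too. *)
case: s {e} s_lt => [_|x s /(_ x (mem_head _ _))[]//].
by have /andP[_] := coset_max_second.1; rewrite subn_gt0.
Qed.

Lemma delta3_max i : odd i -> is_coset_leader q N i ->
  [\/ i = delta q N 1, i = delta q N 2 | i <= delta q N 3].
Proof.
move=> oi li; rewrite delta1E delta2E; have [s [e so _ s_all]] := deltaP.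
case: (s_all i oi li) => [->|->|si]; [constructor 1|constructor 2|constructor 3] => //.
rewrite /delta e /=; case: s so si {e s_all} => // x s /= path_x.
have tr : transitive gtn by move=> y z t /= yz zt; apply: ltn_trans zt yz.
rewrite inE => /predU1P[->//|ys].
by have /allP/(_ _ ys) := order_path_min tr path_x; apply: ltnW.
Qed.

(** The bound excludes exactly [q = 3], [m = 2]; otherwise there is an explicit odd coset maximum
    above [second_max]. *)
Lemma delta3_leader : 25 <= q ^ m ->
  odd (delta q N 3) && is_coset_leader q N (delta q N 3).
Proof.
move=> q25; have [s [e _ s_mem s_all]] := deltaP.
suff : s != [::].
  by rewrite /delta e /=; case: s s_mem {e s_all} => //= x s /(_ x (mem_head _ _))[-> ->].
have [M [oM hM M2M]] : exists M, [/\ odd M, coset_max M & second_max < M].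
  have [m3|m3] := leqP 3 m.
    exists (2 * q ^ m.-1 + 1); split; [by rewrite oddD oddM| exact: coset_max_2pow1|].
    have := @pow3_lt (m %/ 3) ((m + 2) %/ 3) ltac:(lia) ltac:(lia) ltac:(lia).
    by rewrite /second_max; clear; lia.
  have m2 : m = 2 by clear -m3 m_gt1; lia.
  have q4 : 4 < q.
    move: q25 q_odd; rewrite m2 expnS expn1 => q25.
    by case: (q) q25 => [|[|[|[|[]]]]].
  exists (3 * q); split; [by rewrite oddM q_odd | exact: coset_max_3pow1|].
  by rewrite /second_max /pow3 m2 /= expn0 expn1; clear -q4; lia.
have [oi iN li] := coset_max_leader oM hM; have M12 := pow1_lt_second_max.
by have /andP[_ MN] := hM.1; case: (s_all _ oi li) => [e1|e1|]; [lia|lia|by case: (s)].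
Qed.

Lemma refl_modN i M j : i = N - M -> M < N -> 0 < M ->
  (i * q ^ j = i %[mod N]) <-> (M * q ^ j = M %[mod N]).
Proof.
move=> -> MN M0; have := coset_max_refl j MN M0.
have -> : (N - M) %% N = N - M by rewrite modn_small; lia.
by rewrite (modn_small MN); lia.
Qed.

Lemma count_coset_delta1 : count (mem (coset (delta q N 1))) (iota 0 N) = m.
Proof.
have /andP[M0 MN] := coset_max_pow1.1.
apply: count_coset; first by lia.
  by rewrite -modnMmr expm_eq1_modN modnMmr muln1.
by move=> j jm /(refl_modN j delta1E MN M0); apply: pow1_aperiodic.
Qed.

Lemma count_coset_delta2 : count (mem (coset (delta q N 2))) (iota 0 N) = second_size.
Proof.
have /andP[M0 MN] := coset_max_second.1.
apply: count_coset; first by rewrite /second_size; case: eqP; lia.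
  by apply/(refl_modN _ delta2E MN M0)/second_max_period.
by move=> j jm /(refl_modN j delta2E MN M0); apply: second_max_aperiodic.
Qed.

(** A shorter period would produce an odd leader strictly between the third and the second. *)
Lemma count_coset_delta3 : 25 <= q ^ m ->
  count (mem (coset (delta q N 3))) (iota 0 N) = m.
Proof.
move=> /delta3_leader /andP[o3 l3]; apply: count_coset; first by lia.
  by rewrite -modnMmr expm_eq1_modN modnMmr muln1.
have [M [e3 oM MN hM]] := odd_leaderE o3 l3.
have /andP[M0 _] := hM.1; have /andP[_ M2N] := coset_max_second.1.
have M2M : second_max < M by have := delta3_lt; rewrite delta2E e3; lia.
move=> j jm /(refl_modN j e3 MN M0) /(coset_max_between oM hM M2M jm).
case=> M' [oM' hM' M2M' M'M]; have M12 := pow1_lt_second_max.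
have [oi iN li] := coset_max_leader oM' hM'.
by case: (delta3_max oi li); rewrite ?delta1E ?delta2E ?e3; lia.
Qed.

End Rotations.

(** * The generator polynomial *)

Section Lcmp.
Variable K : fieldType.
Implicit Types p r c : {poly K}.

Lemma mul_lcmp_gcdp p r : lcmp p r * gcdp p r = p * r.
Proof. by rewrite /lcmp divpK // dvdp_mulr // dvdp_gcdl. Qed.

Lemma dvdp_lcmpl p r : p %| lcmp p r.
Proof. by rewrite /lcmp -divp_mulA ?dvdp_gcdr // dvdp_mulr. Qed.

Lemma dvdp_lcmpr p r : r %| lcmp p r.
Proof. by rewrite /lcmp mulrC -divp_mulA ?dvdp_gcdl // dvdp_mulr. Qed.

Lemma root_dvdp p r x : p %| r -> root p x -> root r x.
Proof. by move=> pr; rewrite -!dvdp_XsubCl => /dvdp_trans; apply. Qed.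

Lemma root_lcmp p r x : root (lcmp p r) x = root p x || root r x.
Proof.
apply/idP/orP => [h|[]].
- by apply/orP; rewrite -rootM -mul_lcmp_gcdp rootM h.
- by apply: root_dvdp; apply: dvdp_lcmpl.
- by apply: root_dvdp; apply: dvdp_lcmpr.
Qed.

(** After division by the gcd, the cofactors of [p] and [r] are coprime, so Gauss' lemma applies to
    the quotient of [c] by [p]. *)
Lemma lcmp_dvdp p r c : p != 0 -> p %| c -> r %| c -> lcmp p r %| c.
Proof.
move=> p0 /dvdpP[c' ->]; rewrite -(mulrC p).
have g0 : gcdp p r != 0 by rewrite gcdp_eq0 negb_and p0.
rewrite /lcmp -divp_mulA ?dvdp_gcdr // dvdp_mul2l // => h.
rewrite -(@Gauss_dvdpr _ _ (p %/ gcdp p r)); last first.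
  by rewrite coprimep_sym coprimep_div_gcd // p0.
rewrite -(dvdp_mul2r _ _ g0) divpK ?dvdp_gcdr //.
by rewrite mulrAC divpK ?dvdp_gcdl.
Qed.

Lemma root_big_lcmp I (s : seq I) (f : I -> {poly K}) x :
  root (\big[@lcmp K/1]_(i <- s) f i) x = has (fun i => root (f i) x) s.
Proof.
elim: s => [|i s IHs]; first by rewrite big_nil (negbTE (root1 _)).
by rewrite big_cons root_lcmp IHs.
Qed.

Lemma big_lcmp_dvdp I (s : seq I) (f : I -> {poly K}) c :
  (forall i, f i != 0) -> (forall i, f i %| c) ->
  \big[@lcmp K/1]_(i <- s) f i %| c.
Proof.
move=> f0 fc; elim/big_rec: _ => [|i p _ pc]; first exact: dvd1p.
exact: lcmp_dvdp.
Qed.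

End Lcmp.

(** * The Frobenius map and the base field *)

Section Frobenius.
Variables (F : finFieldType) (L : fieldExtType F).
Local Notation q := #|F|.

Lemma pchar_nat_card : [pchar L].-nat q.
Proof.
have [p p_pr pF] := finPcharP F.
have -> : q = (p ^ logn p q)%N by exact: (@card_pprimeChar p F pF).
by rewrite pnatX pnatE // (pchar_lalg L) pF.
Qed.

(** [X^q - X] splits over [F] with the elements of [F] as roots, so it has no further roots in
    [L]. *)
Lemma mem_vline1_expr_card (x : L) : (x \in 1%VS) = (x ^+ q == x).
Proof.
apply/idP/eqP => [/vlineP[a ->]|xq]; first by rewrite exprZn expr1n expf_card.
have : root (map_poly (in_alg L) ('X^q - 'X)) x.
  by rewrite rmorphB /= map_polyXn map_polyX /root !hornerE xq subrr.
rewrite finField_genPoly rmorph_prod /=.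
under eq_bigr do rewrite map_polyXsubC.
rewrite /root horner_prod => /prodf_eq0[a _].
by rewrite hornerXsubC subr_eq0 => /eqP->; apply/vlineP; exists a.
Qed.

Definition frob (x : L) : L := x ^+ q.

Lemma frob_zmod : zmod_morphism frob.
Proof.
move=> x y; rewrite /frob exprDn_pchar ?pchar_nat_card //; congr (_ + _).
apply: (addrI (y ^+ q)); rewrite -exprDn_pchar ?pchar_nat_card // !subrr.
by rewrite expr0n; case: q (finNzRing_gt1 F).
Qed.

Lemma frob_monoid : monoid_morphism frob.
Proof. by split=> [|x y]; rewrite /frob ?expr1n ?exprMn. Qed.

HB.instance Definition _ := GRing.isZmodMorphism.Build L L frob frob_zmod.
HB.instance Definition _ := GRing.isMonoidMorphism.Build L L frob frob_monoid.

Lemma polyOver_frob (p : {poly L}) :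
  (p \is a polyOver 1%VS) = (map_poly frob p == p).
Proof.
apply/polyOverP/eqP => [h|h i].
  by apply/polyP => i; rewrite coef_map; apply/eqP; rewrite -mem_vline1_expr_card.
by rewrite mem_vline1_expr_card; apply/eqP; rewrite -[in RHS]h coef_map.
Qed.

Lemma root_frob (p : {poly L}) x j : p \is a polyOver 1%VS ->
  root p x -> root p (x ^+ (q ^ j)).
Proof.
rewrite polyOver_frob => /eqP pE px.
elim: j => [|j IHj]; first by rewrite expr1.
by rewrite expnSr exprM -/(frob _) -pE fmorph_root.
Qed.

End Frobenius.

(** * Roots and degree of the generator *)

Section Generator.
Variables (F : finFieldType) (L : fieldExtType F) (m : nat) (beta : L).
Local Notation q := #|F|.
Local Notation N := (q ^ m).-1.
Local Notation n := N./2.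
Hypotheses (q_odd : odd q) (m_gt1 : (1 < m)%N).
Lemma card_gt2 : (2 < q)%N.
Proof. by move: q_odd (finNzRing_gt1 F); case: q => [|[|[]]]. Qed.

Local Notation q_gt2 := card_gt2.

Lemma double_n : (2 * n)%N = N.
Proof.
by rewrite mul2n -[in RHS](odd_double_half N) (N_even m q_odd).
Qed.

Lemma n_gt0 : (0 < n)%N.
Proof. by have := q_expm_gt8 q_odd q_gt2 m_gt1; have := double_n; lia. Qed.

Hypothesis beta_prim : N.-primitive_root beta.

(** Frobenius permutes the linear factors at the conjugates cyclically, so their product lies over
    [F] and the minimal polynomial divides it. Repeated factors do no harm, as only roots are
    compared. *)
Lemma root_minPoly_expr a s : (s < N)%N ->
  root (minPoly 1%VS (beta ^+ a)) (beta ^+ s) = (s \in coset q m a).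
Proof.
move=> sN; apply/idP/(cosetP q_odd q_gt2 m_gt1) => [|[j ->]]; last first.
  rewrite (prim_expr_mod beta_prim) exprM.
  by apply: root_frob; rewrite ?minPolyOver ?root_minPoly.
pose f j := 'X - (beta ^+ (a * q ^ j))%:P.
pose P := \prod_(j < m) f j.
have m1 : m = m.-1.+1 by rewrite prednK //; apply: ltnW.
have P_over : P \is a polyOver 1%VS.
  rewrite polyOver_frob rmorph_prod /=.
  have E (j : 'I_m) : map_poly (@frob F L) (f j) = f j.+1.
    by rewrite /f map_polyXsubC /= /frob -exprM -mulnA -expnSr.
  under eq_bigr => j _ do rewrite E.
  rewrite /P m1 big_ord_recr big_ord_recl /= mulrC; apply/eqP; congr (_ * _).
  rewrite -m1 /f expn0 muln1 -(prim_expr_mod beta_prim) -modnMmr.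
  by rewrite (expm_eq1_modN q_odd q_gt2 m_gt1) modnMmr muln1 (prim_expr_mod beta_prim).
have Pa : root P (beta ^+ a).
  rewrite /P m1 big_ord_recl rootM /f expn0 muln1.
  by rewrite root_XsubC eqxx.
move/(root_dvdp (minPoly_dvdp P_over Pa)); rewrite /P /root horner_prod.
case/prodf_eq0 => j _; rewrite hornerXsubC subr_eq0 (eq_prim_root_expr beta_prim).
by rewrite modn_small // => /eqP->; exists j.
Qed.

Lemma beta_expn : beta ^+ n = -1.
Proof.
have : (beta ^+ n) ^+ 2 == 1.
  by rewrite -exprM mulnC double_n (prim_expr_order beta_prim).
rewrite sqrf_eq1 => /orP[|/eqP//]; rewrite -(expr0 beta).
rewrite (eq_prim_root_expr beta_prim) mod0n modn_small; last first.
  by have := double_n; have := n_gt0; lia.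
by move=> /eqP e; have := n_gt0; rewrite e.
Qed.

Section Delta.
Variable delta : nat.
Local Notation g := (bch_generator delta beta).

Lemma minPoly_expr_neq0 a : minPoly 1%VS (beta ^+ a) != 0.
Proof. by rewrite monic_neq0 // monic_minPoly. Qed.

Lemma root_bch_generator s : (s < N)%N ->
  root g (beta ^+ s) = [exists i : 'I_delta.-1, s \in coset q m (2 * i + 1)].
Proof.
move=> sN; rewrite /bch_generator root_big_lcmp; apply/hasP/existsP => [[i _]|[i si]].
  by rewrite root_minPoly_expr //; exists i.
by exists i; rewrite ?mem_index_enum ?root_minPoly_expr.
Qed.

Lemma bch_generator_dvdp : g %| 'X^n + 1.
Proof.
apply: big_lcmp_dvdp => [i|i]; first exact: minPoly_expr_neq0.
apply: minPoly_dvdp; first by rewrite rpredD ?rpredX ?polyOverX ?rpred1.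
rewrite /root !hornerE -exprM mulnC exprM beta_expn addn1 exprS exprM sqrrN.
by rewrite !expr1n mulr1 addNr.
Qed.

Lemma bch_generator_over : g \is a polyOver 1%VS.
Proof.
apply: (big_ind (fun p => p \is a polyOver 1%VS)); first exact: rpred1.
  move=> p r hp hr; rewrite /lcmp.
  by apply: divp_polyOver; [apply: rpredM | apply: gcdp_polyOver].
by move=> i _; apply: minPolyOver.
Qed.

(** [g] divides [X^N - 1], a product of distinct linear factors, so its degree is the number of its
    roots. *)
Lemma size_bch_generator :
  size g = (count (fun s => root g (beta ^+ s)) (iota 0 N)).+1.
Proof.
have : g %| \prod_(s <- iota 0 N) ('X - (beta ^+ s)%:P).
  have := factor_Xn_sub_1 beta_prim; rewrite /index_iota subn0 => ->.
  apply: dvdp_trans bch_generator_dvdp _.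
  have -> : 'X^N - 1 = ('X^n - 1) * ('X^n + 1) :> {poly L}.
    by rewrite -subr_sqr_1 -exprM mulnC double_n.
  exact: dvdp_mull.
case/dvdp_prod_XsubC => b gE; set t := mask b _ in gE.
have t_lt s : s \in t -> (s < N)%N by move=> /mem_mask; rewrite mem_iota.
rewrite (eqp_size gE) size_prod_XsubC -size_filter; congr _.+1.
apply: perm_size; apply: uniq_perm.
- exact/mask_uniq/iota_uniq.
- exact/filter_uniq/iota_uniq.
move=> s; rewrite mem_filter mem_iota add0n /= (eqp_root gE).
rewrite -(big_map (fun s => beta ^+ s) xpredT (fun x => 'X - x%:P)) root_prod_XsubC.
apply/idP/andP => [st|[/mapP[s' s't /eqP e] sN]]; first by rewrite map_f ?t_lt.
move: e; rewrite (eq_prim_root_expr beta_prim) (modn_small sN).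
by rewrite (modn_small (t_lt _ s't)) => /eqP->.
Qed.

End Delta.

End Generator.

(** * Dimension and weights of polynomial codes *)

Section Codes.
Variable F : finFieldType.
Local Notation q := #|F|.

Definition weight n (x : 'rV[F]_n) := #|[set i | x 0 i != 0]|.

Lemma hammingE n (x y : 'rV[F]_n) : hamming x y = weight (x - y).
Proof. by apply: eq_card => i; rewrite !inE !mxE subr_eq0. Qed.

Definition mul_row (g : {poly F}) k n (u : 'rV[F]_k) : 'rV[F]_n :=
  poly_rV (rVpoly u * g).

Lemma mul_row_linear g k n : linear (@mul_row g k n).
Proof. by move=> a u v; rewrite /mul_row linearP mulrDl -scalerAl linearP. Qed.

HB.instance Definition _ g k n :=
  GRing.isLinear.Build F 'rV[F]_k 'rV[F]_n _ (@mul_row g k n) (@mul_row_linear g k n).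

(** Multiplication by [g] is injective on polynomials of degree less than [n - deg g], and its image
    consists of the multiples of [g] of degree less than [n]. *)
Lemma poly_code_vspace n (g : {poly F}) : g != 0 -> ((size g).-1 <= n)%N ->
  exists2 U : {vspace 'rV[F]_n}, (forall c, (c \in U) = (g %| rVpoly c)) &
    \dim U = (n - (size g).-1)%N.
Proof.
move=> g0 gn; have sg : (0 < size g)%N by rewrite size_poly_gt0.
set k := (n - _)%N; pose f := linfun (@mul_row g k n).
have size_le (u : 'rV_k) : (size (rVpoly u * g)%R <= n)%N.
  have [->|u0] := eqVneq (rVpoly u) 0; first by rewrite mul0r size_poly0.
  rewrite size_mul //; apply: (@leq_trans (k + size g).-1).
    by rewrite -!subn1 leq_sub2r // leq_add2r size_poly.
  by rewrite /k; move: (size g) sg gn; lia.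
exists (limg f); last first.
  rewrite limg_dim_eq; first by rewrite dimvf dim_matrix; apply: mul1n.
  apply/eqP; rewrite -subv0; apply/subvP => u.
  rewrite memv_cap memv_ker memvf lfunE /= /mul_row => /eqP/(congr1 (@rVpoly _ _)).
  rewrite poly_rV_K // linear0 => /eqP; rewrite mulf_eq0 (negbTE g0) orbF => /eqP e.
  by rewrite memv0 -[u]rVpolyK e linear0.
move=> c; apply/memv_imgP/dvdpP => [[u _ ->]|[a e]].
  by exists (rVpoly u); rewrite lfunE /= /mul_row poly_rV_K.
exists (poly_rV a); first exact: memvf.
rewrite lfunE /= /mul_row poly_rV_K -?e ?rVpolyK //.
have [->|a0] := eqVneq a 0; first by rewrite size_poly0.
have : (size (rVpoly c) <= n)%N := size_poly _ _.
rewrite e size_mul // -!subn1 leq_subLR /k.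
by move: (size a) (size g) sg gn => x y; lia.
Qed.

Definition row_coord n (i : 'I_n) (x : 'rV[F]_n) : F^o := x 0 i.

Lemma row_coord_linear n (i : 'I_n) : linear (row_coord i).
Proof. by move=> a x y; rewrite /row_coord !mxE. Qed.

HB.instance Definition _ n i :=
  GRing.isLinear.Build F 'rV[F]_n F^o _ (@row_coord n i) (row_coord_linear i).

(** The words of [U] vanishing at [i] form a subspace of codimension at most 1. *)
Lemma card_coord_neq0 n (U : {vspace 'rV[F]_n}) (i : 'I_n) :
  (#|[set x in U | x 0%R i != 0%R]| <= q ^ \dim U - q ^ (\dim U).-1)%N.
Proof.
pose f := linfun (row_coord i).
have ker_dim : ((\dim U).-1 <= \dim (U :&: lker f))%N.
  have := limg_ker_dim f U; have : (\dim (f @: U) <= 1)%N.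
    by apply: leq_trans (dimvS (subvf _)) _; rewrite dimvf.
  by move=> f1 <-; rewrite -subn1 leq_subLR addnC leq_add2r.
have -> : [set x in U | x 0 i != 0] = [set x in U] :\: [set x in (U :&: lker f)%VS].
  apply/setP => x; rewrite !inE memv_cap memv_ker lfunE /= /row_coord.
  by case: (x \in U) => //=; rewrite andbT.
rewrite cardsD (setIidPr _); last first.
  by apply/subsetP => x; rewrite !inE memv_cap => /andP[].
rewrite !cardsE !card_vspace leq_sub2l // leq_pexp2l //.
exact: ltnW (finNzRing_gt1 F).
Qed.

(* Plotkin's argument: average the weight over all nonzero words. *)
Lemma exists_low_weight n (U : {vspace 'rV[F]_n}) D :
  (n * (q ^ \dim U - q ^ (\dim U).-1) < (q ^ \dim U).-1 * D.+1)%N ->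
  exists x, [/\ x \in U, x != 0 & (weight x <= D)%N].
Proof.
move=> lt; pose low x := [&& x \in U, x != 0 & (weight x <= D)%N].
have [[x xU]|none] := altP (@existsP _ low).
  by exists x; apply/and3P.
suff : ((q ^ \dim U).-1 * D.+1 <= n * (q ^ \dim U - q ^ (\dim U).-1))%N.
  by rewrite leqNgt lt.
have -> : (q ^ \dim U).-1 = #|[set x in U] :\ 0|.
  by rewrite cardsDS ?sub1set ?inE ?mem0v // cards1 subn1 cardsE card_vspace.
apply: (@leq_trans (\sum_(x in [set x in U] :\ 0) weight x)).
  rewrite -sum_nat_const; apply: leq_sum => x; rewrite !inE => /andP[x0 xU].
  rewrite ltnNge; apply: contra none => xD.
  by apply/existsP; exists x; rewrite /low xU x0.
apply: (@leq_trans (\sum_(x in U) weight x)).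
  rewrite [leqRHS](bigID (fun x => x == 0)) /= addnC -[leqLHS]addn0 leq_add //.
  by apply/eq_leq/eq_bigl => x; rewrite !inE andbC.
(* Double counting: the total weight is summed coordinate by coordinate. *)
under eq_bigr do rewrite /weight -sum1dep_card big_mkcond /=.
rewrite exchange_big /= -[X in (_ <= X * _)%N]card_ord -sum_nat_const.
apply: leq_sum => i _; apply: leq_trans (card_coord_neq0 U i).
by rewrite -big_mkcondr sum1dep_card; apply/eq_leq/eq_card => x; rewrite !inE.
Qed.

Lemma code_dim_vspace k (C : {set 'rV[F]_k}) (U : {vspace 'rV[F]_k}) :
  (forall c, (c \in U) = (c \in C)) -> code_dim C = \dim U.
Proof.
move=> memU; congr (\dim _); apply/eqP; rewrite eqEsubv.
apply/andP; split; first by apply/span_subvP => c; rewrite mem_enum memU.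
by apply/subvP => c; rewrite memU => cC; rewrite memv_span ?mem_enum.
Qed.

Lemma min_dist_ge_vspace k (C : {set 'rV[F]_k}) (U : {vspace 'rV[F]_k}) d :
  (forall c, (c \in U) = (c \in C)) -> (0 < \dim U)%N ->
  (forall c, c \in U -> c != 0 -> (d <= weight c)%N) -> min_dist_ge C d.
Proof.
move=> memU dimU wt; split; last first.
  move=> x y xC yC xy; rewrite hammingE wt ?subr_eq0 //.
  by rewrite rpredB ?memU.
rewrite -(eq_card memU) card_vspace; have q1 := finNzRing_gt1 F.
exact: leq_trans q1 (@leq_pexp2l q 1 _ (ltnW q1) dimU).
Qed.

(** If the weight were below [D], a polynomial [P] of degree at most [D - 2] would vanish at all
    nodes [beta ^+ (2 * i)] of the support except one. Combining the given root equations with the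
    coefficients of [P] leaves a single nonzero term equal to 0. *)
Lemma bch_bound (L : fieldExtType F) n (beta : L) (c : 'rV[F]_n) D :
  (2 * n)%N.-primitive_root beta -> c != 0 ->
  (forall k, (k < D.-1)%N -> root (map_poly (in_alg L) (rVpoly c)) (beta ^+ (2 * k + 1))) ->
  (D <= weight c)%N.
Proof.
move=> prim c0 roots; rewrite leqNgt; apply/negP => lt.
have [i0 ci0] : exists i, c 0 i != 0.
  apply/existsP; rewrite -negb_forall; apply: contra c0 => /forallP h.
  by apply/eqP/rowP => i; rewrite mxE; apply/eqP.
pose A := [set i | c 0 i != 0]; pose node (i : 'I_n) := beta ^+ (2 * i).
pose P := \prod_(i in A :\ i0) ('X - (node i)%:P).
have sizeP : (size P <= D.-1)%N.
  rewrite /P -big_enum /= size_prod_XsubC -cardE; have i0A : i0 \in A by rewrite inE.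
  by move: lt; rewrite /weight -/A (cardsD1 i0 A) i0A; lia.
have : \sum_i (in_alg L (c 0 i) * beta ^+ i) * P.[node i] = 0.
  under eq_bigr do rewrite horner_coef mulr_sumr.
  rewrite exchange_big big1 //= => k _.
  have /rootP := roots k (leq_trans (ltn_ord k) sizeP).
  rewrite (horner_coef_wide _ (_ : _ <= n)%N); last first.
    by rewrite size_map_poly size_poly.
  move/(congr1 ( *%R P`_k)); rewrite mulr0; apply: etrans.
  rewrite mulr_sumr; apply: eq_bigr => i _.
  rewrite coef_map coef_rVpoly_ord /node -!exprM mulrCA; congr (_ * _).
    by rewrite -mulrA -exprD; congr (_ * _ ^+ _); lia.
rewrite (bigD1 i0) //= big1 ?addr0 => [|i ii0].
  apply/eqP; rewrite !mulf_eq0 !negb_or expf_neq0 ?andbT.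
    rewrite scaler_eq0 oner_eq0 orbF ci0 /=; apply/negP; rewrite horner_prod => /prodf_eq0[i].
    rewrite !inE => /andP[ii0 _]; rewrite hornerXsubC subr_eq0.
    rewrite (eq_prim_root_expr prim) !modn_small ?ltn_pmul2l // => /eqP e.
    by case/negP: ii0; apply/eqP/val_inj => /=; lia.
  have n0 : (0 < n)%N := leq_ltn_trans (leq0n _) (ltn_ord i0).
  apply/eqP => b0; have := prim_expr_order prim.
  by rewrite b0 expr0n eqn0Ngt muln_gt0 n0 => /esym/eqP; rewrite oner_eq0.
have [ci|ci] := eqVneq (c 0 i) 0; first by rewrite ci scale0r !mul0r.
rewrite /P horner_prod (bigD1 i) ?inE ?ii0 //=.
by rewrite hornerXsubC subrr !(mul0r, mulr0).
Qed.

End Codes.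

(** * Parameters of the negacyclic code *)

Section Assembly.
Variables (F : finFieldType) (L : fieldExtType F) (m : nat) (beta : L).
Local Notation q := #|F|.
Local Notation N := (q ^ m).-1.
Local Notation n := N./2.
Hypotheses (q_odd : odd q) (m_gt1 : (1 < m)%N).
Hypothesis beta_prim : N.-primitive_root beta.

Let q_gt2 := card_gt2 q_odd.

(** As [g] divides [X^n + 1], reduction preserves divisibility by [g], and the code consists of the
    multiples of [g] of degree less than [n]. *)
Lemma negacyclic_BCH_vspace delta : exists2 U : {vspace 'rV[F]_n},
  forall c, (c \in U) = (c \in negacyclic_BCH n delta beta) &
  \dim U = (n - count (fun s => root (bch_generator delta beta) (beta ^+ s)) (iota 0 N))%N /\
  forall c s, c \in U -> root (bch_generator delta beta) (beta ^+ s) ->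
    root (map_poly (in_alg L) (rVpoly c)) (beta ^+ s).
Proof.
set g := bch_generator _ _.
have g_dvd : g %| 'X^n + 1 := bch_generator_dvdp q_odd m_gt1 beta_prim delta.
have /polyOver1P[g0 gE] : g \is a polyOver 1%VS by apply: bch_generator_over.
have Xn0 : size ('X^n + 1 : {poly L}) = n.+1.
  by rewrite -polyC1 size_XnaddC // (n_gt0 q_odd m_gt1).
have size_g0 : size g0 = size g by rewrite gE size_map_poly.
have g_neq0 : g0 != 0.
  rewrite -size_poly_eq0 size_g0 size_poly_eq0.
  by apply: contraTneq g_dvd => ->; rewrite dvd0p -size_poly_eq0 Xn0.
have le_n : ((size g0).-1 <= n)%N.
  have := dvdp_leq (_ : 'X^n + 1 != 0) g_dvd.
  by rewrite -size_poly_eq0 Xn0 size_g0 => /(_ isT); case: (size g).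
have [U memU dimU] := poly_code_vspace g_neq0 le_n.
exists U; last split.
- move=> c; rewrite memU inE; apply/idP/existsP => [/dvdpP[a e]|[a /eqP e]].
    exists (poly_rV a); rewrite poly_rV_K; last first.
      have [->|a0] := eqVneq a 0; first by rewrite size_poly0.
      have : (size (rVpoly c) <= n)%N := size_poly _ _.
      have : (0 < size g0)%N by rewrite size_poly_gt0.
      by rewrite e size_mul //; move: (size a) (size g0) => x y; lia.
    rewrite -/g gE -rmorphM /= -e modp_small // Xn0 size_map_poly ltnS.
    exact: size_poly.
  by rewrite -(dvdp_map (in_alg L)) e -gE -dvdp_mod // dvdp_mull.
- by rewrite dimU size_g0 (size_bch_generator q_odd m_gt1 beta_prim).
- by move=> c s; rewrite memU -(dvdp_map (in_alg L)) -gE => /root_dvdp; apply.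
Qed.

Lemma count_odd k : count odd (iota 0 k) = (k./2)%N.
Proof.
elim: k => // k IHk; rewrite -[k.+1]addn1 iotaD count_cat IHk /= add0n addn0 addn1.
by have -> : k.+1./2%N = uphalf k by []; rewrite uphalf_half addnC.
Qed.

Lemma root_bch_generator_leader delta i s : (s < N)%N -> odd i ->
  (i < 2 * delta.-1)%N -> s \in coset q m i ->
  root (bch_generator delta beta) (beta ^+ s).
Proof.
move=> sN oi lt si; rewrite (root_bch_generator q_odd m_gt1 beta_prim) //; apply/existsP.
have k_lt : (i./2 < delta.-1)%N by have := odd_double_half i; rewrite oi; lia.
exists (Ordinal k_lt); rewrite /= (_ : 2 * i./2 + 1 = i)%N //.
by rewrite -[RHS](odd_double_half i) oi mul2n addnC.
Qed.

(** Each odd [s] is counted once: its leader either belongs to [ls] or lies below [2 * delta.-1].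
    Even [s] are never counted, because cosets preserve parity. *)
Lemma count_root_cosets delta (ls : seq nat) : uniq ls ->
  {in ls, forall l, [/\ odd l, is_coset_leader q N l & (2 * delta.-1 < l)%N]} ->
  (forall i, odd i -> is_coset_leader q N i -> i \in ls \/ (i < 2 * delta.-1)%N) ->
  (count (fun s => root (bch_generator delta beta) (beta ^+ s)) (iota 0 N) +
   \sum_(l <- ls) count (mem (coset q m l)) (iota 0 N))%N = n.
Proof.
move=> uls lsP cover; rewrite -(count_odd N).
have countE (a : pred nat) s : count a s = (\sum_(x <- s) a x)%N.
  by rewrite -sum1_count big_mkcond; apply: eq_bigr => x _; case: (a x).
rewrite !countE; under [in X in (_ + X)%N]eq_bigr do rewrite countE.
rewrite exchange_big /= -big_split /= big_seq [RHS]big_seq; apply: eq_bigr => s.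
rewrite mem_iota add0n /= => sN.
rewrite (root_bch_generator q_odd m_gt1 beta_prim) //.
have [i li si] := leader_exists q_odd q_gt2 m_gt1 sN.
have osi := coset_odd q_odd q_gt2 m_gt1 si.
have unique l : l \in ls -> s \in coset q m l -> l = i.
  by move=> /lsP[_ ll _] sl; apply: (leader_unique q_odd q_gt2 m_gt1 ll li sl si).
have root_lt : [exists k : 'I_delta.-1, s \in coset q m (2 * k + 1)] ->
    odd i /\ (i < 2 * delta.-1)%N.
  case/existsP => k sk; split.
    by rewrite -osi (coset_odd q_odd q_gt2 m_gt1 sk) oddD oddM.
  apply: (@leq_ltn_trans (2 * k + 1)); last by have := ltn_ord k; lia.
  exact: (leader_le_coset q_odd q_gt2 m_gt1 li si sk).
have [ils|nils] := boolP (i \in ls).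
  have [oi _ lt_i] := lsP i ils.
  rewrite (bigD1_seq i) //= si big_seq_cond big1 => [|l /andP[lls li']]; last first.
    by case: (boolP (s \in coset q m l)) => // /(unique l lls) e; rewrite e eqxx in li'.
  by rewrite osi oi; case: [exists _, _] root_lt => // /(_ isT)[_]; rewrite ltnNge ltnW.
rewrite big_seq big1 => [|l lls]; last first.
  by case: (boolP (s \in coset q m l)) => // /(unique l lls) e; rewrite -e lls in nils.
rewrite addn0 osi; congr nat_of_bool; apply/idP/idP => [/root_lt[]//|oi].
have [/(negP nils)//|lt] := cover i oi li.
by rewrite -(root_bch_generator q_odd m_gt1 beta_prim) // (root_bch_generator_leader sN oi lt).
Qed.

(* The exponents below the least leader [l0] left out of the defining set give
   consecutive roots, whence the BCH bound [(l0 + 1) / 2]. *)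
Lemma negacyclic_BCH_params delta (ls : seq nat) l0 : uniq ls -> l0 \in ls ->
  {in ls, forall l,
    [/\ odd l, is_coset_leader q N l, (2 * delta.-1 < l)%N & (l0 <= l)%N]} ->
  (forall i, odd i -> is_coset_leader q N i -> i \in ls \/ (i < 2 * delta.-1)%N) ->
  exists U : {vspace 'rV[F]_n},
  [/\ forall c, (c \in U) = (c \in negacyclic_BCH n delta beta),
      \dim U = (\sum_(l <- ls) count (mem (coset q m l)) (iota 0 N))%N &
      forall c, c \in U -> c != 0 -> ((l0 + 1) %/ 2 <= weight c)%N].
Proof.
move=> uls l0ls lsP cover; have [U memU [dimU rootU]] := negacyclic_BCH_vspace delta.
exists U; split=> // [|c cU c0].
  rewrite dimU -[X in (X - _)%N](count_root_cosets uls _ cover) ?addKn //.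
  by move=> l /lsP[].
apply: (bch_bound (beta := beta) _ c0); first by rewrite double_n.
move=> k k_lt; apply: rootU => //.
have nl : (2 * k + 1 < l0)%N by lia.
have [_ /andP[l0N _] _ _] := lsP l0 l0ls; have sN := ltn_trans nl l0N.
have [i li si] := leader_exists q_odd q_gt2 m_gt1 sN.
have oi : odd i by rewrite -(coset_odd q_odd q_gt2 m_gt1 si) oddD oddM.
have i_le := leader_le q_odd q_gt2 m_gt1 li si.
case: (cover i oi li) => [/lsP[_ _ _]|lt]; first by clear -i_le nl; lia.
exact: root_bch_generator_leader lt si.
Qed.

End Assembly.

Theorem theorem21 (F : finFieldType) (L : fieldExtType F) (q m : nat)
    (beta : L) (delta_ : nat) :
  #|F| = q -> odd q -> (2 <= m)%N ->
  let N := (q ^ m).-1 in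
  let n := N./2 in
  (2 * n)%N.-primitive_root beta ->
  let d1 := delta q N 1 in
  let d2 := delta q N 2 in
  let d3 := delta q N 3 in
  let kappa := if (m %% 3 == 0)%N then (m %/ 3)%N else m in
  [/\ (2 <= delta_)%N -> ((d2 + 3) %/ 2 <= delta_ <= (d1 + 1) %/ 2)%N ->
        code_dim (negacyclic_BCH n delta_ beta) = m /\
        is_min_dist (negacyclic_BCH n delta_ beta) ((d1 + 1) %/ 2),
      (2 <= delta_)%N -> ((d3 + 3) %/ 2 <= delta_ <= (d2 + 1) %/ 2)%N ->
        code_dim (negacyclic_BCH n delta_ beta) = (m + kappa)%N /\
        min_dist_ge (negacyclic_BCH n delta_ beta) ((d2 + 1) %/ 2)
    & (25 <= q ^ m)%N ->
        code_dim (negacyclic_BCH n ((d3 + 1) %/ 2) beta) = (2 * m + kappa)%N /\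
        min_dist_ge (negacyclic_BCH n ((d3 + 1) %/ 2) beta) ((d3 + 1) %/ 2)].
Proof.
move=> <- q_odd m_gt1 N n; rewrite double_n // => prim d1 d2 d3 kappa.
have q_gt2 := card_gt2 q_odd.
have params := negacyclic_BCH_params q_odd m_gt1 prim.
have [d1_odd d1_leader] : odd d1 /\ is_coset_leader #|F| N d1.
  rewrite /d1 delta1E //.
  have c1 := coset_max_pow1 q_odd q_gt2 m_gt1.
  by have [-> _ ->] := coset_max_leader q_odd q_gt2 m_gt1 (odd_pow1 m q_odd) c1.
have [d2_odd d2_leader] : odd d2 /\ is_coset_leader #|F| N d2.
  rewrite /d2 delta2E //.
  have c2 := coset_max_second q_odd q_gt2 m_gt1.
  by have [-> _ ->] := coset_max_leader q_odd q_gt2 m_gt1 (odd_second_max m q_odd) c2.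
have d3_max := delta3_max q_odd q_gt2 m_gt1; rewrite -/d1 -/d2 -/d3 in d3_max.
have d32 : (d3 < d2)%N by apply: delta3_lt.
have d21 : (d2 < d1)%N.
  rewrite /d1 /d2 delta1E ?delta2E //.
  have := pow1_lt_second_max q_odd q_gt2 m_gt1.
  by have /andP[_] := (coset_max_second q_odd q_gt2 m_gt1).1; lia.
have kappa_gt0 : (0 < kappa)%N by rewrite /kappa; case: eqP; lia.
have c1 : count (mem (coset #|F| m d1)) (iota 0 N) = m by apply: count_coset_delta1.
have c2 : count (mem (coset #|F| m d2)) (iota 0 N) = kappa by apply: count_coset_delta2.
split.
- move=> delta_ge2 /andP[le_d ge_d].
  (* The bounds on [delta_] give [d2 < 2 * delta_.-1 < d1], so only the coset of [d1] is left
     out. *)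
  have [|||i oi li|U [memU dimU wtU]] := params delta_ [:: d1] d1.
  + by [].
  + exact: mem_head.
  + by move=> l; rewrite inE => /eqP->; split=> //; lia.
  + rewrite inE; case: (d3_max i oi li) => [->|e|le]; [by left|right; lia|right; lia].
  rewrite big_seq1 c1 in dimU; rewrite (code_dim_vspace memU) dimU; split=> //.
  have dimU0 : (0 < \dim U)%N by rewrite dimU ltnW.
  have [_ wt] := min_dist_ge_vspace memU dimU0 wtU.
  split; last exact: wt.
  (* With [D = (d1 + 1) / 2] one has [q ^ m - q ^ m.-1 = 2 * D], so the averaging condition reads
     [N * D < N * (D + 1)]. *)
  have [x [xU x0 wx]] : exists x, [/\ x \in U, x != 0 & (weight x <= (d1 + 1) %/ 2)%N].
    apply: exists_low_weight; rewrite dimU.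
    have eq : (#|F| ^ m = #|F| * #|F| ^ m.-1)%N by rewrite -expnS prednK // ltnW.
    have eD : (#|F| ^ m - #|F| ^ m.-1 = 2 * ((d1 + 1) %/ 2))%N.
      have := two_pow_lt_N q_odd q_gt2 m_gt1.
      have := odd_pow1 m q_odd; have := N_even m q_odd.
      rewrite /d1 delta1E // -/N /N; move: (#|F| ^ m)%N (#|F| ^ m.-1)%N => P Q.
      by clear; lia.
    rewrite eD mulnA (mulnC n) double_n // ltn_mul2l ltnSn andbT.
    exact: N_gt0.
  exists x, 0; rewrite -!memU; split=> //; first exact: mem0v.
  by apply/eqP; rewrite hammingE subr0 eqn_leq wx wtU.
- move=> delta_ge2 /andP[le_d ge_d].
  have [|||i oi li|U [memU dimU wtU]] := params delta_ [:: d1; d2] d2.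
  + by rewrite /= inE; lia.
  + by rewrite !inE eqxx orbT.
  + by move=> l; rewrite !inE => /orP[]/eqP->; split=> //; lia.
  + by rewrite !inE; case: (d3_max i oi li) => [->|->|le];
      [left|left|right; lia]; rewrite eqxx ?orbT.
  rewrite big_cons big_seq1 c1 c2 in dimU; rewrite (code_dim_vspace memU) dimU.
  by split=> //; apply: (min_dist_ge_vspace memU _ wtU); rewrite dimU; lia.
move=> q25; have /andP[d3_odd d3_leader] : odd d3 && is_coset_leader #|F| N d3.
  exact: delta3_leader.
have c3 : count (mem (coset #|F| m d3)) (iota 0 N) = m by apply: count_coset_delta3.
(* For this designed distance [2 * (delta - 1) = d3 - 1], so the coset of [d3] is left out as
   well. *)
have [|||i oi li|U [memU dimU wtU]] := params ((d3 + 1) %/ 2)%N [:: d1; d2; d3] d3.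
+ by rewrite /= !inE; lia.
+ by rewrite !inE eqxx !orbT.
+ by move=> l; rewrite !inE => /or3P[]/eqP->; split=> //; lia.
+ rewrite !inE; case: (d3_max i oi li) => [->|->|le]; rewrite ?eqxx ?orbT; [by left|by left|].
  by have [->|ne] := eqVneq i d3; [left; rewrite !orbT|right; lia].
rewrite !big_cons big_nil c1 c2 c3 in dimU; rewrite (code_dim_vspace memU) dimU.
split; first by lia.
by apply: (min_dist_ge_vspace memU _ wtU); rewrite dimU; lia.
Qed.
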